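(* Let $N\ge2$ be even, $M_2=N/2$, and let $a$ be odd. The linear code over $\mathbb{Z}_N$ generated by the rows of $$g=\begin{pmatrix} M_2 & M_2 & 0 & 0 & 0 \\ {} M_2 & 0 & M_2 & 1 & -1 \\ 0 & 0 & 0 & a & -a \end{pmatrix}$$ is isomorphic to the code generated by the rows of $$g_0=\begin{pmatrix} M_2 & M_2 & 0 & 0 & 0 \\ {} M_2 & 0 & M_2 & 0 & 0 \\ 0 & 0 & 0 & 1 & -1 \end{pmatrix}.$$ This is a direct sum; in particular, the corresponding simplex is a free join of $2\Delta_2$ and a $1$-dimensional interval of length $N$.
   Context: $\mathbb{Z}_N=\mathbb{Z}/N\mathbb{Z}$. A linear code of length $n$ over $\mathbb{Z}_N$ is a submodule of $\mathbb{Z}_N^n$. Two codes over the same $\mathbb{Z}_N$ and of the same length are isomorphic if they coincide after a permutation of coordinates. Direct sum: for codes $C_1$ over $\mathbb{Z}_{N_1}$ and $C_2$ over $\mathbb{Z}_{N_2}$, with $L=\operatorname{lcm}(N_1,N_2)$, $C_1\oplus C_2$ is the code over $\mathbb{Z}_L$ consisting of all concatenations $\frac{L}{N_1}c_1\,|\,\frac{L}{N_2}c_2$, $c_i\in C_i$. Simplex of a code: for a code $C\subseteq\mathbb{Z}_N^{d+1}$ all of whose words have coordinate sum $0\bmod N$, let $M=\pi^{-1}(C)\subseteq\mathbb{Z}^{d+1}$ with $\pi:\mathbb{Z}^{d+1}\to\mathbb{Z}_N^{d+1}$ the reduction map; the corresponding simplex is $\operatorname{conv}(Ne_0,\dots,Ne_d)$,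 viewed as a lattice simplex with respect to the affine lattice $\operatorname{aff}(Ne_0,\dots,Ne_d)\cap M$. Lattice simplices are considered up to affine unimodular isomorphism. $2\Delta_2=\operatorname{conv}\{(0,0),(2,0),(0,2)\}\subset\mathbb{R}^2$. The free join of lattice polytopes $\Delta_1,\Delta_2$ of dimensions $d_1,d_2$ is $\operatorname{conv}(\Delta_1\times\{0^{d_2}\}\times\{0\},\ \{0^{d_1}\}\times\Delta_2\times\{1\})\subset\mathbb{R}^{d_1+d_2+1}$. *)

(* Defs.v *)
From mathcomp Require Import all_boot all_order all_fingroup all_algebra.
From mathcomp Require Import all_classical all_reals.

Set Implicit Arguments.
Unset Strict Implicit.
Unset Printing Implicit Defensive.

Import Order.TTheory GRing.Theory Num.Theory.

Local Open Scope classical_set_scope.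
Local Open Scope ring_scope.

(** * Codes

    The ring Z/NZ is ['Z_N], which is the intended ring only for [1 < N]; a code
    of length [n] over it is a [set 'rV['Z_N]_n]. *)

Definition linear_code (N n : nat) (C : set 'rV['Z_N]_n) : Prop :=
  C 0 /\ forall (k : 'Z_N) (x y : 'rV['Z_N]_n), C x -> C y -> C (k *: x + y).

Definition code_span (N k n : nat) (G : 'M['Z_N]_(k, n)) : set 'rV['Z_N]_n :=
  [set u *m G | u in [set: 'rV['Z_N]_k]].

Lemma code_span_linear (N k n : nat) (G : 'M['Z_N]_(k, n)) :
  linear_code (code_span G).
Proof.
split; first by exists 0 => //; rewrite mul0mx.
move=> c _ _ [u _ <-] [v _ <-]; exists (c *: u + v) => //.
by rewrite mulmxDl scalemxAl.
Qed.

Lemma code_span_row (N k n : nat) (G : 'M['Z_N]_(k, n)) (i : 'I_k) :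
  code_span G (row i G).
Proof. by exists (delta_mx 0 i) => //; rewrite rowE. Qed.

Lemma code_span_min (N k n : nat) (G : 'M['Z_N]_(k, n)) (C : set 'rV['Z_N]_n) :
  linear_code C -> (forall i, C (row i G)) -> code_span G `<=` C.
Proof.
move=> [C0 CD] CG _ [u _ <-]; rewrite mulmx_sum_row.
elim/big_ind: _ => // [x y Cx Cy | i _].
  by rewrite -[x]scale1r; apply: CD.
by rewrite -[_ *: _]addr0; apply: CD.
Qed.

Definition code_iso (N n : nat) (C C' : set 'rV['Z_N]_n) : Prop :=
  exists s : 'S_n, [set col_perm s c | c in C] = C'.

(** [scale_word N L] is c |-> (L / N) c from Z_N^n to Z_L^n, computed on the
    representatives in [0, N); when [N %| L] it does not depend on their choice. *)
Definition scale_word (N L n : nat) (c : 'rV['Z_N]_n) : 'rV['Z_L]_n :=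
  map_mx (fun x : 'Z_N => ((L %/ N * x)%N%:R : 'Z_L)) c.
Arguments scale_word {N} L {n} c.

(** A relation rather than an operation, so that the modulus [L] need only be
    propositionally equal to the lcm. *)
Definition direct_sum (N1 N2 L n1 n2 : nat)
    (C1 : set 'rV['Z_N1]_n1) (C2 : set 'rV['Z_N2]_n2)
    (C : set 'rV['Z_L]_(n1 + n2)) : Prop :=
  L = lcmn N1 N2 /\
  C = [set c | exists2 c1, C1 c1 & exists2 c2, C2 c2 &
               c = row_mx (scale_word L c1) (scale_word L c2)].
Arguments direct_sum {N1 N2 L n1 n2} C1 C2 C.

(** * Polytopes and lattices in R^n *)

Definition aff_hull (R : realType) (n : nat) (A : set 'rV[R]_n) : set 'rV[R]_n :=
  [set x | exists k (p : 'I_k -> 'rV[R]_n) (w : 'I_k -> R),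
    [/\ forall i, A (p i), \sum_i w i = 1 & x = \sum_i w i *: p i]].

Definition conv_hull (R : realType) (n : nat) (A : set 'rV[R]_n) : set 'rV[R]_n :=
  [set x | exists k (p : 'I_k -> 'rV[R]_n) (w : 'I_k -> R),
    [/\ forall i, A (p i), forall i, 0 <= w i,
        \sum_i w i = 1 & x = \sum_i w i *: p i]].

Definition int_lattice (R : realType) (n : nat) : set 'rV[R]_n :=
  [set map_mx intr z | z in [set: 'rV[int]_n]].
Arguments int_lattice : clear implicits.

(** Affine unimodular isomorphism between a polytope [P1] with respect to an
    affine lattice [L1] in aff(P1) and a polytope [P2] with respect to [L2]: an
    affine bijection aff(P1) -> aff(P2) carrying [L1] onto [L2] and [P1] onto
    [P2].  The ambient dimensions may differ. *)
Definition unimodular_iso (R : realType) (m n : nat)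
    (L1 P1 : set 'rV[R]_m) (L2 P2 : set 'rV[R]_n) : Prop :=
  exists (A : 'M[R]_(m, n)) (b : 'rV[R]_n),
    let f := fun x : 'rV[R]_m => x *m A + b in
    [/\ set_bij (aff_hull P1) (aff_hull P2) f, f @` L1 = L2 & f @` P1 = P2].

Definition free_join (R : realType) (d1 d2 : nat)
    (P1 : set 'rV[R]_d1) (P2 : set 'rV[R]_d2) : set 'rV[R]_(d1 + d2 + 1) :=
  conv_hull ([set row_mx (row_mx x (0 : 'rV_d2)) (0 : 'rV_1) | x in P1] `|`
             [set row_mx (row_mx (0 : 'rV_d1) y) (const_mx 1 : 'rV_1) | y in P2]).

Definition two_Delta2 (R : realType) : set 'rV[R]_2 :=
  conv_hull [set (0 : 'rV[R]_2); 2 *: delta_mx 0 0; 2 *: delta_mx 0 1].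
Arguments two_Delta2 : clear implicits.

Definition interval_of_length (R : realType) (N : nat) : set 'rV[R]_1 :=
  conv_hull [set (0 : 'rV[R]_1); const_mx N%:R].
Arguments interval_of_length : clear implicits.

(** * The simplex of a code *)

Definition zero_sum_code (N n : nat) (C : set 'rV['Z_N]_n) : Prop :=
  forall c, C c -> \sum_i c 0 i = 0.

Definition code_vertices (R : realType) (N n : nat) : set 'rV[R]_n :=
  [set N%:R *: delta_mx 0 i | i in [set: 'I_n]].
Arguments code_vertices : clear implicits.

(** The preimage of [C] under the reduction Z^n -> Z_N^n, viewed in R^n. *)
Definition code_preimage (R : realType) (N n : nat) (C : set 'rV['Z_N]_n) :
    set 'rV[R]_n :=
  [set map_mx intr z | z in
    [set z : 'rV[int]_n | C (map_mx (fun k : int => k%:~R : 'Z_N) z)]].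
Arguments code_preimage R {N n} C _.

Definition code_simplex (R : realType) (N n : nat) : set 'rV[R]_n :=
  conv_hull (code_vertices R N n).
Arguments code_simplex : clear implicits.

Definition code_lattice (R : realType) (N n : nat) (C : set 'rV['Z_N]_n) :
    set 'rV[R]_n :=
  aff_hull (code_vertices R N n) `&` code_preimage R C.
Arguments code_lattice R {N n} C _.

(** * The generator matrices *)

Definition mx_of_rows (N k n : nat) (s : seq (seq 'Z_N)) : 'M['Z_N]_(k, n) :=
  \matrix_(i < k, j < n) (nth [::] s i)`_j.

Definition g_mx (N : nat) (a : int) : 'M['Z_N]_(3, 5) :=
  let M2 : 'Z_N := (N %/ 2)%:R in
  mx_of_rows 3 5
    [:: [:: M2; M2; 0;  0;      0];
        [:: M2; 0;  M2; 1;      -1];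
        [:: 0;  0;  0;  a%:~R;  - a%:~R]].

Definition g0_mx (N : nat) : 'M['Z_N]_(3, 5) :=
  let M2 : 'Z_N := (N %/ 2)%:R in
  mx_of_rows 3 5
    [:: [:: M2; M2; 0;  0; 0];
        [:: M2; 0;  M2; 0; 0];
        [:: 0;  0;  0;  1; -1]].

(** The two summands: the code over Z_2 whose simplex is [two_Delta2], and the
    code over Z_N whose simplex is an interval of length [N]. *)
Definition h1_mx : 'M['Z_2]_(2, 3) :=
  mx_of_rows 2 3 [:: [:: 1; 1; 0]; [:: 1; 0; 1]].

Definition h2_mx (N : nat) : 'M['Z_N]_(1, 2) :=
  mx_of_rows 1 2 [:: [:: 1; -1]].

(* Main.v *)
(** Write [M = N / 2], so [2 M = 0] in Z_N.  If [a = 2 b + 1], then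
    [g_3 - 2 b g_2 = (0, 0, 0, 1, -1)] and [a g_2 - g_3 = (M, 0, M, 0, 0)], so the
    two codes are already equal and the permutation is the identity.  A lattice
    point of the simplex has the form [(x0, M p, M q, r, N t - r)] with [p, q, r, t]
    arbitrary integers and [x0] fixed by the coordinate sum [N]; the coordinates
    [(p, q, r, t)] identify the lattice with Z^4 and send the five vertices
    [N e_i] to the vertices of the free join. *)
Require Import Defs.
From mathcomp Require Import all_boot all_order all_fingroup all_algebra.
From mathcomp Require Import all_classical all_reals.
From mathcomp Require Import ring lra.

Import Order.TTheory GRing.Theory Num.Theory.

Local Open Scope classical_set_scope.
Local Open Scope ring_scope.

Lemma forall_ord5 (P : 'I_5 -> Prop) :
  P 0 -> P 1 -> P 2 -> P 3 -> P 4 -> forall i, P i.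
Proof.
move=> P0 P1 P2 P3 P4 [[|[|[|[|[|//]]]]] lt_i].
- by rewrite (_ : Ordinal _ = 0) //; apply: val_inj.
- by rewrite (_ : Ordinal _ = 1) //; apply: val_inj.
- by rewrite (_ : Ordinal _ = 2) //; apply: val_inj.
- by rewrite (_ : Ordinal _ = 3) //; apply: val_inj.
- by rewrite (_ : Ordinal _ = 4) //; apply: val_inj.
Qed.

Lemma forall_ord4 (P : 'I_4 -> Prop) :
  P 0 -> P 1 -> P 2 -> P 3 -> forall i, P i.
Proof.
move=> P0 P1 P2 P3 [[|[|[|[|//]]]] lt_i].
- by rewrite (_ : Ordinal _ = 0) //; apply: val_inj.
- by rewrite (_ : Ordinal _ = 1) //; apply: val_inj.
- by rewrite (_ : Ordinal _ = 2) //; apply: val_inj.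
- by rewrite (_ : Ordinal _ = 3) //; apply: val_inj.
Qed.

Lemma forall_ord3 (P : 'I_3 -> Prop) : P 0 -> P 1 -> P 2 -> forall i, P i.
Proof.
move=> P0 P1 P2 [[|[|[|//]]] lt_i].
- by rewrite (_ : Ordinal _ = 0) //; apply: val_inj.
- by rewrite (_ : Ordinal _ = 1) //; apply: val_inj.
- by rewrite (_ : Ordinal _ = 2) //; apply: val_inj.
Qed.

Lemma sum_ord5 (V : nmodType) (F : 'I_5 -> V) :
  \sum_i F i = F 0 + F 1 + F 2 + F 3 + F 4.
Proof.
rewrite !big_ord_recl big_ord0 addr0 !addrA.
by congr (_ + F _ + F _ + F _ + F _); apply: val_inj.
Qed.

Lemma sum_ord2 (V : nmodType) (F : 'I_2 -> V) : \sum_i F i = F 0 + F 1.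
Proof.
by rewrite !big_ord_recl big_ord0 addr0; congr (_ + F _); apply: val_inj.
Qed.

Lemma sum_ord3 (V : nmodType) (F : 'I_3 -> V) : \sum_i F i = F 0 + F 1 + F 2.
Proof.
rewrite !big_ord_recl big_ord0 addr0 !addrA.
by congr (_ + F _ + F _); apply: val_inj.
Qed.

Lemma code_span_mul (N k l n : nat) (T : 'M['Z_N]_(l, k)) (G : 'M['Z_N]_(k, n)) :
  code_span (T *m G) `<=` code_span G.
Proof. by move=> _ [u _ <-]; exists (u *m T) => //; rewrite mulmxA. Qed.

Lemma intr_Zp_eq0 (N : nat) (z : int) :
  (1 < N)%N -> (z%:~R == 0 :> 'Z_N) = (N%:Z %| z)%Z.
Proof.
move=> N_gt1; rewrite dvdzE absz_nat.
have natE (m : nat) : (m%:R == 0 :> 'Z_N) = (N %| m)%N.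
  by rewrite -val_eqE /= val_Zp_nat.
by case: z => m; rewrite ?NegzE ?mulrNz ?oppr_eq0 ?abszN natE.
Qed.

Lemma half_double (N : nat) : ~~ odd N -> N = (N %/ 2 * 2)%N.
Proof. by move=> evN; rewrite divnK // dvdn2. Qed.

Lemma g_span_eq (N : nat) (a : int) :
  (2 <= N)%N -> ~~ odd N -> ~~ (2 %| a)%Z ->
  code_span (g_mx N a) = code_span (g0_mx N).
Proof.
move=> N_ge2 N_even a_odd.
have M2 : (N %/ 2)%:R * 2 = 0 :> 'Z_N.
  by rewrite -natrM -half_double // pchar_Zp.
have [b ab] : exists b : int, a = 2 * b + 1.
  exists (a %/ 2)%Z; rewrite {1}(divz_eq a 2) mulrC; congr (_ + _).
  have := modz_ge0 a (isT : 2 != 0 :> int); have := ltz_pmod a (isT : 0 < 2 :> int).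
  move: a_odd; rewrite (sameP dvdz_mod0P eqP).
  by case: (modz a 2) => [[|[|]]|].
have aM : a%:~R * (N %/ 2)%:R = (N %/ 2)%:R :> 'Z_N.
  by rewrite ab rmorphD rmorphM /=; ring: M2.
pose t (s : seq (seq 'Z_N)) := mx_of_rows 3 3 s.
have gE : g_mx N a = t [:: [:: 1; 0; 0]; [:: 0; 1; 1]; [:: 0; 0; a%:~R]] *m g0_mx N.
  apply/matrixP; apply: forall_ord3; apply: forall_ord5;
    rewrite !mxE sum_ord3 !mxE /=; ring.
have g0E : g0_mx N = t [:: [:: 1; 0; 0]; [:: 0; a%:~R; -1]; [:: 0; 1 - a%:~R; 1]]
    *m g_mx N a.
  apply/matrixP; apply: forall_ord3; apply: forall_ord5;
    rewrite !mxE sum_ord3 !mxE /=; ring: aM.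
rewrite eqEsubset; split; [rewrite gE | rewrite g0E]; exact: code_span_mul.
Qed.

Lemma mem_g0_span (N : nat) (c : 'rV['Z_N]_5) :
  let M : 'Z_N := (N %/ 2)%:R in
  code_span (g0_mx N) c <->
  exists u v, [/\ c 0 0 = M * (u + v), c 0 1 = M * u, c 0 2 = M * v &
                  c 0 4 = - c 0 3].
Proof.
move=> M; split=> [[u _ <-] | [u [v [c0 c1 c2 c4]]]].
  by exists (u 0 0), (u 0 1); rewrite !mxE !sum_ord3 !mxE /=; split; ring.
exists (\row_(j < 3) [:: u; v; c 0 3]`_j) => //.
apply/rowP; apply: forall_ord5;
  rewrite mxE sum_ord3 !mxE /= ?c0 ?c1 ?c2 ?c4; ring.
Qed.

Lemma g0_span_zero_sum (N : nat) :
  (2 <= N)%N -> ~~ odd N -> zero_sum_code (code_span (g0_mx N)).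
Proof.
move=> N_ge2 N_even c /mem_g0_span[u [v [c0 c1 c2 c4]]].
have M2 : (N %/ 2)%:R * 2 = 0 :> 'Z_N.
  by rewrite -natrM -half_double // pchar_Zp.
rewrite sum_ord5 c0 c1 c2 c4; ring: M2.
Qed.

Lemma row_mx_lE (T : Type) (m n : nat) (x : 'rV[T]_m) (y : 'rV[T]_n)
    (i : 'I_(m + n)) (j : 'I_m) : i = j :> nat -> row_mx x y 0 i = x 0 j.
Proof. by move=> ij; rewrite (_ : i = lshift n j) ?row_mxEl //; apply: val_inj. Qed.

Lemma row_mx_rE (T : Type) (m n : nat) (x : 'rV[T]_m) (y : 'rV[T]_n)
    (i : 'I_(m + n)) (j : 'I_n) : i = (m + j)%N :> nat -> row_mx x y 0 i = y 0 j.
Proof. by move=> ij; rewrite (_ : i = rshift m j) ?row_mxEr //; apply: val_inj. Qed.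

Lemma half_mul_Z2 (N m : nat) : (2 <= N)%N -> ~~ odd N ->
  (N %/ 2 * (m%:R : 'Z_2))%:R = (N %/ 2)%:R * m%:R :> 'Z_N.
Proof.
move=> N_ge2 N_even; rewrite val_Zp_nat // -natrM {2}(divn_eq m 2) mulnDr.
by rewrite mulnCA -half_double // natrD (natrM _ _ N) pchar_Zp // mulr0 add0r.
Qed.

Lemma mem_h1_span (c : 'rV['Z_2]_3) :
  code_span h1_mx c <-> c 0 0 = c 0 1 + c 0 2.
Proof.
have [h00 h01 h02] : [/\ h1_mx 0 0 = 1, h1_mx 0 1 = 1 & h1_mx 0 2 = 0].
  by split; rewrite mxE.
have [h10 h11 h12] : [/\ h1_mx 1 0 = 1, h1_mx 1 1 = 0 & h1_mx 1 2 = 1].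
  by split; rewrite mxE.
split=> [[u _ <-] | c0].
  rewrite !mxE !sum_ord2 h00 h01 h02 h10 h11 h12; ring.
pose u : 'rV['Z_2]_2 := \row_(i < 2) [:: c 0 1; c 0 2]`_i.
have [u0 u1] : u 0 0 = c 0 1 /\ u 0 1 = c 0 2 by rewrite !mxE.
exists u => //; apply/rowP; apply: forall_ord3;
  rewrite mxE sum_ord2 u0 u1 ?h00 ?h01 ?h02 ?h10 ?h11 ?h12 ?c0; ring.
Qed.

Lemma mem_h2_span (N : nat) (c : 'rV['Z_N]_2) :
  code_span (h2_mx N) c <-> c 0 1 = - c 0 0.
Proof.
split=> [[u _ <-] | c1].
  rewrite !mxE !big_ord1 !mxE /=; ring.
exists (c 0 0)%:M => //; rewrite mul_scalar_mx.
apply/rowP=> -[[|[|//]] lt_i]; rewrite !mxE /=.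
  by rewrite mulr1; congr (c _ _); apply: val_inj.
by rewrite mulrN1 -c1; congr (c _ _); apply: val_inj.
Qed.

Lemma g0_direct_sum (N : nat) : (2 <= N)%N -> ~~ odd N ->
  @direct_sum 2 N N 3 2 (code_span h1_mx) (code_span (h2_mx N))
    (code_span (g0_mx N)).
Proof.
move=> N_ge2 N_even; have N_gt0 : (0 < N)%N by apply: ltnW.
split; first by apply/esym/lcmn_idPr; rewrite dvdn2.
have scale1 (x : 'Z_N) : (N %/ N * x)%:R = x by rewrite divnn N_gt0 mul1n natr_Zp.
have scaleM (x : 'Z_2) : (N %/ 2 * x)%:R = (N %/ 2)%:R * (x : nat)%:R :> 'Z_N.
  by rewrite -[in LHS](natr_Zp x) half_mul_Z2.
have scaleD (x y : 'Z_2) : (N %/ 2 * (x + y)%R)%:R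
    = (N %/ 2)%:R * ((x : nat)%:R + (y : nat)%:R) :> 'Z_N.
  by rewrite -natrD -half_mul_Z2 // natrD !natr_Zp.
rewrite eqEsubset; split=> c.
  case/mem_g0_span=> u [v [c0 c1 c2 c4]].
  have [w0 w0E] : exists w : 'Z_2, w = (u : nat)%:R by eexists.
  have [w1 w1E] : exists w : 'Z_2, w = (v : nat)%:R by eexists.
  have [s sE] : exists s : 'Z_2, s = w0 + w1 by eexists.
  exists (\row_(j < 3) [:: s; w0; w1]`_j); first by apply/mem_h1_span; rewrite !mxE.
  exists (\row_(j < 2) [:: c 0 3; - c 0 3]`_j).
    by apply/mem_h2_span; rewrite !mxE.
  set x := scale_word _ _; set y := scale_word _ _.
  apply/rowP; apply: (forall_ord5 (fun i => c 0 i = row_mx x y 0 i)).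
  - rewrite (@row_mx_lE _ _ _ _ _ _ 0) // !mxE /= sE scaleD c0 w0E w1E.
    by rewrite mulrDr [RHS]mulrDr -!scaleM !half_mul_Z2 // !natr_Zp.
  - by rewrite (@row_mx_lE _ _ _ _ _ _ 1) // !mxE /= w0E half_mul_Z2 // natr_Zp.
  - by rewrite (@row_mx_lE _ _ _ _ _ _ 2) // !mxE /= w1E half_mul_Z2 // natr_Zp.
  - by rewrite (@row_mx_rE _ _ _ _ _ _ 0) // !mxE scale1.
  - by rewrite (@row_mx_rE _ _ _ _ _ _ 1) // !mxE scale1.
case=> x /mem_h1_span x0 [y /mem_h2_span y1 ->]; apply/mem_g0_span.
exists (x 0 1 : nat)%:R, (x 0 2 : nat)%:R.
rewrite !(@row_mx_lE _ 3 2 _ _ 0 0) // !(@row_mx_lE _ 3 2 _ _ 1 1) //.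
rewrite !(@row_mx_lE _ 3 2 _ _ 2 2) // !(@row_mx_rE _ 3 2 _ _ 3 0) //.
by rewrite !(@row_mx_rE _ 3 2 _ _ 4 1) // !mxE !scale1 x0 scaleD !scaleM y1.
Qed.

Section Hulls.
Context {R : realType}.

Lemma sub_conv_hull (n : nat) (P : set 'rV[R]_n) : P `<=` conv_hull P.
Proof.
move=> x Px; exists 1%N, (fun=> x), (fun=> 1); split=> //.
  by rewrite big_ord1.
by rewrite big_ord1 scale1r.
Qed.

Lemma aff_hull_mulmx (m n : nat) (A : 'M[R]_(m, n)) (P : set 'rV[R]_m)
    (Q : set 'rV[R]_n) (x : 'rV[R]_m) :
  (forall p, P p -> Q (p *m A)) -> aff_hull P x -> aff_hull Q (x *m A).
Proof.
move=> PQ [k [p [w [Pp w1 ->]]]]; exists k, (fun i => p i *m A), w.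
split=> // [i|]; first exact: PQ.
by rewrite mulmx_suml; apply: eq_bigr => i _; rewrite scalemxAl.
Qed.

Lemma conv_hull_mulmx (m n : nat) (A : 'M[R]_(m, n)) (P : set 'rV[R]_m)
    (Q : set 'rV[R]_n) (x : 'rV[R]_m) :
  (forall p, P p -> Q (p *m A)) -> conv_hull P x -> conv_hull Q (x *m A).
Proof.
move=> PQ [k [p [w [Pp w0 w1 ->]]]]; exists k, (fun i => p i *m A), w.
split=> // [i|]; first exact: PQ.
by rewrite mulmx_suml; apply: eq_bigr => i _; rewrite scalemxAl.
Qed.

Lemma conv_hull_ge (n : nat) (P : set 'rV[R]_n) (l : 'rV[R]_n -> R) (c : R) :
  scalar l -> (forall x, P x -> c <= l x) ->
  forall x, conv_hull P x -> c <= l x.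
Proof.
move=> lL Pl _ [k [p [w [Pp w0 w1 ->]]]].
have l0 : l 0 = 0.
  by have := lL (-1) 0 0; rewrite scaler0 addr0 mulN1r addNr.
have -> : l (\sum_i w i *: p i) = \sum_i w i * l (p i).
  by elim/big_rec2: _ => // i y z _ <-; rewrite lL.
rewrite -[c]mul1r -w1 mulr_suml; apply: ler_sum => i _.
by apply: ler_wpM2l; [exact: w0 | exact: Pl].
Qed.

End Hulls.

Section CodeSimplex.
Context {R : realType} (N n : nat) (N_gt0 : (0 < N)%N).

Let N_neq0 : N%:R != 0 :> R. Proof. by rewrite pnatr_eq0 -lt0n. Qed.

Lemma vertex_decomposition (x : 'rV[R]_n) :
  x = \sum_i (x 0 i / N%:R) *: (N%:R *: delta_mx 0 i).
Proof.
by rewrite {1}[x]row_sum_delta; apply: eq_bigr => i _; rewrite scalerA divfK.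
Qed.

Lemma vertex_sum (x : 'rV[R]_n) : code_vertices R N n x -> \sum_j x 0 j = N%:R.
Proof.
move=> [i _ <-]; rewrite (bigD1 i) //= big1 ?addr0 => [|j ji]; rewrite !mxE eqxx.
  by rewrite eqxx mulr1.
by rewrite (negbTE ji) mulr0.
Qed.

Lemma aff_hull_vertices (S : set 'rV[R]_n) :
  code_vertices R N n `<=` S -> S `<=` [set x | \sum_i x 0 i = N%:R] ->
  aff_hull S = [set x | \sum_i x 0 i = N%:R].
Proof.
move=> VS SN; rewrite eqEsubset; split=> x /=.
  move=> [k [p [w [Sp w1 ->]]]].
  under eq_bigr do rewrite summxE; rewrite exchange_big /=.
  transitivity (\sum_i w i * N%:R); last by rewrite -mulr_suml w1 mul1r.
  apply: eq_bigr => i _; rewrite -(SN _ (Sp i)) mulr_sumr.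
  by apply: eq_bigr => j _; rewrite mxE.
move=> xN; exists n, (fun i => N%:R *: delta_mx 0 i), (fun i => x 0 i / N%:R).
split=> [i||]; [by apply: VS; exists i | | exact: vertex_decomposition].
by rewrite -mulr_suml xN divff.
Qed.

Lemma code_simplexE : code_simplex R N n =
  [set x | \sum_i x 0 i = N%:R /\ forall i, 0 <= x 0 i].
Proof.
rewrite eqEsubset; split=> x /=.
  move=> cx; split.
    have : aff_hull (code_vertices R N n) x.
      by case: cx => k [p [w [? ? ? ?]]]; exists k, p, w.
    by rewrite aff_hull_vertices //; apply: vertex_sum.
  move=> i; apply: (conv_hull_ge _ _ (fun y => y 0 i)) cx => [k u v|].
    by rewrite !mxE.
  by move=> _ [j _ <-]; rewrite !mxE mulr_ge0 // ler0n.
move=> [xN x0]; exists n, (fun i => N%:R *: delta_mx 0 i), (fun i => x 0 i / N%:R).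
split=> [i|i||]; [by exists i | by rewrite divr_ge0 | | exact: vertex_decomposition].
by rewrite -mulr_suml xN divff.
Qed.

End CodeSimplex.

Section JoinMap.
Context {R : realType} {N : nat} (N_ge2 : (2 <= N)%N) (N_even : ~~ odd N).

Let N_gt0 : 0 < N%:R :> R. Proof. by rewrite ltr0n ltnW. Qed.
Let N_neq0 : N%:R != 0 :> R. Proof. by rewrite gt_eqF. Qed.

(** [x |-> (p, q, r, t) = (2 x1 / N, 2 x2 / N, x3, (x3 + x4) / N)] *)
Definition join_map : 'M[R]_(5, 4) :=
  \matrix_(i < 5, j < 4) (nth [::]
    [:: [:: 0; 0; 0; 0];
        [:: 2 / N%:R; 0; 0; 0];
        [:: 0; 2 / N%:R; 0; 0];
        [:: 0; 0; 1; N%:R^-1];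
        [:: 0; 0; 0; N%:R^-1]] i)`_j.

Definition join_inv (y : 'rV[R]_4) : 'rV[R]_5 :=
  \row_(i < 5)
    [:: N%:R - N%:R / 2 * y 0 0 - N%:R / 2 * y 0 1 - N%:R * y 0 3;
        N%:R / 2 * y 0 0; N%:R / 2 * y 0 1; y 0 2; N%:R * y 0 3 - y 0 2]`_i.

Lemma join_mapE (x : 'rV[R]_5) :
  [/\ (x *m join_map) 0 0 = x 0 1 * (2 / N%:R),
      (x *m join_map) 0 1 = x 0 2 * (2 / N%:R),
      (x *m join_map) 0 2 = x 0 3 &
      (x *m join_map) 0 3 = (x 0 3 + x 0 4) / N%:R].
Proof. by split; rewrite mxE sum_ord5 !mxE /=; ring. Qed.

Lemma join_inv_sum (y : 'rV[R]_4) : \sum_i join_inv y 0 i = N%:R.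
Proof. by rewrite sum_ord5 !mxE /=; field. Qed.

Lemma join_invK (y : 'rV[R]_4) : join_inv y *m join_map = y.
Proof.
have [y0 y1 y2 y3] := join_mapE (join_inv y).
apply/rowP; apply: forall_ord4; rewrite ?y0 ?y1 ?y2 ?y3 !mxE /=; by field.
Qed.

Lemma join_mapK (x : 'rV[R]_5) :
  \sum_i x 0 i = N%:R -> join_inv (x *m join_map) = x.
Proof.
rewrite sum_ord5 => xN; have [y0 y1 y2 y3] := join_mapE x.
apply/rowP; apply: forall_ord5; rewrite [LHS]mxE /= ?y0 ?y1 ?y2 ?y3 //.
- by rewrite -{1}xN; field: xN.
- by field.
- by field.
- by field.
Qed.

Lemma free_join_ge (y : 'rV[R]_4) :
  free_join (two_Delta2 R) (interval_of_length R N) y ->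
  [/\ 0 <= y 0 0, 0 <= y 0 1, 0 <= y 0 2, y 0 0 + y 0 1 + 2 * y 0 3 <= 2 &
      y 0 2 <= N%:R * y 0 3].
Proof.
have tri (x : 'rV[R]_2) : two_Delta2 R x ->
    [/\ 0 <= x 0 0, 0 <= x 0 1 & x 0 0 + x 0 1 <= 2].
  move=> Tx; split.
  - apply: (conv_hull_ge _ _ (fun x => x 0 0)) Tx => [k u v|p]; first by rewrite !mxE.
    by case=> [[]|] ->; rewrite !mxE /= ?mulr1 ?mulr0.
  - apply: (conv_hull_ge _ _ (fun x => x 0 1)) Tx => [k u v|p]; first by rewrite !mxE.
    by case=> [[]|] ->; rewrite !mxE /= ?mulr1 ?mulr0.
  - rewrite -lerN2; apply: (conv_hull_ge _ _ (fun x => - (x 0 0 + x 0 1))) Tx.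
      by move=> k u v; rewrite !mxE; ring.
    by move=> p; case=> [[]|] ->; rewrite !mxE /=; lra.
have int (x : 'rV[R]_1) : interval_of_length R N x -> 0 <= x 0 0 <= N%:R.
  move=> Ix; apply/andP; split.
    apply: (conv_hull_ge _ _ (fun x => x 0 0)) Ix => [k u v|p]; first by rewrite !mxE.
    by case=> ->; rewrite !mxE // ltW.
  rewrite -lerN2; apply: (conv_hull_ge _ _ (fun x => - x 0 0)) Ix => [k u v|p].
    by rewrite !mxE; ring.
  by case=> ->; rewrite !mxE ?lexx // oppr0 oppr_le0 ltW.
have gen (p : 'rV[R]_4) :
    ([set row_mx (row_mx x (0 : 'rV_1)) (0 : 'rV_1) | x in two_Delta2 R] `|`
     [set row_mx (row_mx (0 : 'rV_2) x) (const_mx 1 : 'rV_1)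
       | x in interval_of_length R N]) p ->
    [/\ 0 <= p 0 0, 0 <= p 0 1, 0 <= p 0 2, p 0 0 + p 0 1 + 2 * p 0 3 <= 2 &
      p 0 2 <= N%:R * p 0 3].
  case=> -[x xP <-];
  rewrite !(row_mx_lE _ 3 1 _ _ 0 0) // !(row_mx_lE _ 3 1 _ _ 1 1) //
    !(row_mx_lE _ 3 1 _ _ 2 2) // !(row_mx_rE _ 3 1 _ _ 3 0) //
    !(row_mx_lE _ 2 1 _ _ 0 0) // !(row_mx_lE _ 2 1 _ _ 1 1) //
    !(row_mx_rE _ 2 1 _ _ 2 0) // !mxE.
    by have [] := tri _ xP; split; lra.
  by have /andP[] := int _ xP; split; lra.
move=> Jy; split.
- apply: (conv_hull_ge _ _ (fun x => x 0 (0 : 'I_4))) Jy => [k u v|p /gen[]//].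
  by rewrite !mxE.
- apply: (conv_hull_ge _ _ (fun x => x 0 (1 : 'I_4))) Jy => [k u v|p /gen[]//].
  by rewrite !mxE.
- apply: (conv_hull_ge _ _ (fun x => x 0 (2 : 'I_4))) Jy => [k u v|p /gen[]//].
  by rewrite !mxE.
- rewrite -lerN2; pose l (x : 'rV[R]_4) := - (x 0 0 + x 0 1 + 2 * x 0 3).
  apply: (conv_hull_ge _ _ l) Jy => [k u v|p /gen[_ _ _ + _]].
    by rewrite /l !mxE; ring.
  by rewrite lerN2.
- rewrite -subr_ge0; pose l (x : 'rV[R]_4) := N%:R * x 0 3 - x 0 2.
  apply: (conv_hull_ge _ _ l) Jy => [k u v|p /gen[_ _ _ _]].
    by rewrite /l !mxE; ring.
  by rewrite subr_ge0.
Qed.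

Lemma join_map_vertex (p : 'rV[R]_5) : code_vertices R N 5 p ->
  ([set row_mx (row_mx x (0 : 'rV_1)) (0 : 'rV_1) | x in two_Delta2 R] `|`
   [set row_mx (row_mx (0 : 'rV_2) x) (const_mx 1 : 'rV_1)
     | x in interval_of_length R N]) (p *m join_map).
Proof.
move=> [i _ <-].
have tri (x : 'rV[R]_2) (y : 'rV[R]_4) :
    [set 0; 2 *: delta_mx 0 0; 2 *: delta_mx 0 1] x ->
    x 0 0 = y 0 0 -> x 0 1 = y 0 1 -> 0 = y 0 2 -> 0 = y 0 3 ->
    [set row_mx (row_mx x (0 : 'rV_1)) (0 : 'rV_1) | x in two_Delta2 R] y.
  move=> Vx y0 y1 y2 y3; exists x; first exact: sub_conv_hull.
  apply/rowP; apply: (forall_ord4 (fun i =>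
    row_mx (row_mx x (0 : 'rV_1)) (0 : 'rV_1) 0 i = y 0 i)).
  - by rewrite (row_mx_lE _ 3 1 _ _ 0 0) // (row_mx_lE _ 2 1 _ _ 0 0).
  - by rewrite (row_mx_lE _ 3 1 _ _ 1 1) // (row_mx_lE _ 2 1 _ _ 1 1).
  - by rewrite (row_mx_lE _ 3 1 _ _ 2 2) // (row_mx_rE _ 2 1 _ _ 2 0) // mxE.
  - by rewrite (row_mx_rE _ 3 1 _ _ 3 0) // mxE.
have int (x : 'rV[R]_1) (y : 'rV[R]_4) :
    [set 0; const_mx N%:R] x ->
    0 = y 0 0 -> 0 = y 0 1 -> x 0 0 = y 0 2 -> 1 = y 0 3 ->
    [set row_mx (row_mx (0 : 'rV_2) x) (const_mx 1 : 'rV_1)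
      | x in interval_of_length R N] y.
  move=> Vx y0 y1 y2 y3; exists x; first exact: sub_conv_hull.
  apply/rowP; apply: (forall_ord4 (fun i =>
    row_mx (row_mx (0 : 'rV_2) x) (const_mx 1 : 'rV_1) 0 i = y 0 i)).
  - by rewrite (row_mx_lE _ 3 1 _ _ 0 0) // (row_mx_lE _ 2 1 _ _ 0 0) // mxE.
  - by rewrite (row_mx_lE _ 3 1 _ _ 1 1) // (row_mx_lE _ 2 1 _ _ 1 1) // mxE.
  - by rewrite (row_mx_lE _ 3 1 _ _ 2 2) // (row_mx_rE _ 2 1 _ _ 2 0).
  - by rewrite (row_mx_rE _ 3 1 _ _ 3 0) // mxE.
move: i; apply: forall_ord5.
all: set q := _ *: _; have [y0 y1 y2 y3] := join_mapE q.
- left; apply: (tri 0); [by left; left |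
    by rewrite ?y0 ?y1 ?y2 ?y3 !mxE /=; field ..].
- left; apply: (tri (2 *: delta_mx 0 0)); [by left; right |
    by rewrite ?y0 ?y1 ?y2 ?y3 !mxE /=; field ..].
- left; apply: (tri (2 *: delta_mx 0 1)); [by right |
    by rewrite ?y0 ?y1 ?y2 ?y3 !mxE /=; field ..].
- right; apply: (int (const_mx N%:R)); [by right |
    by rewrite ?y0 ?y1 ?y2 ?y3 !mxE /=; field ..].
- right; apply: (int 0); [by left |
    by rewrite ?y0 ?y1 ?y2 ?y3 !mxE /=; field ..].
Qed.

Lemma join_map_simplex :
  [set x *m join_map | x in code_simplex R N 5] =
  free_join (two_Delta2 R) (interval_of_length R N).
Proof.
rewrite eqEsubset; split=> [_ [x Sx <-] | y Jy].
  exact: conv_hull_mulmx join_map_vertex Sx.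
exists (join_inv y); last exact: join_invK.
rewrite code_simplexE; last exact: ltnW.
split; first exact: join_inv_sum.
have [y0 y1 y2 y01 y23] := free_join_ge y Jy.
apply: forall_ord5; rewrite mxE /=; [| | | by [] | by rewrite subr_ge0].
- have -> : N%:R - N%:R / 2 * y 0 0 - N%:R / 2 * y 0 1 - N%:R * y 0 3 =
    N%:R / 2 * (2 - (y 0 0 + y 0 1 + 2 * y 0 3)) by field.
  by rewrite mulr_ge0 ?subr_ge0 // divr_ge0 // ltW.
- by rewrite mulr_ge0 // divr_ge0 // ltW.
- by rewrite mulr_ge0 // divr_ge0 // ltW.
Qed.

Lemma join_map_bij (P : set 'rV[R]_4) :
  [set x *m join_map | x in code_simplex R N 5] = P ->
  set_bij (aff_hull (code_simplex R N 5)) (aff_hull P) (mulmx^~ join_map).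
Proof.
move=> SP; have aS : aff_hull (code_simplex R N 5) = [set x | \sum_i x 0 i = N%:R].
  apply: aff_hull_vertices; [exact: ltnW | exact: sub_conv_hull |].
  by rewrite code_simplexE; [move=> x [] | exact: ltnW].
split=> [x|x y|y _].
- by apply: aff_hull_mulmx => p Sp; rewrite -SP; exists p.
- rewrite aS !inE => xN yN xy.
  by rewrite -(join_mapK x xN) xy join_mapK.
- by exists (join_inv y); rewrite ?aS ?join_invK //; apply: join_inv_sum.
Qed.

Lemma intr_Zp_eq (z1 z2 : int) : z1%:~R = z2%:~R :> 'Z_N ->
  exists k : int, z1 = z2 + N%:Z * k.
Proof.
move/eqP; rewrite -subr_eq0 -rmorphB /= intr_Zp_eq0 // => /dvdzP[k zk].
by exists k; rewrite mulrC -zk; ring.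
Qed.

Lemma half_double_int : N%:Z = 2 * (N %/ 2)%:Z.
Proof. by rewrite {1}(half_double N) // PoszM mulrC. Qed.

Lemma g0_preimageP (z : 'rV[int]_5) :
  code_span (g0_mx N) (map_mx (fun k : int => k%:~R : 'Z_N) z) <->
  exists p q k t : int, let M := (N %/ 2)%:Z in
  [/\ z 0 0 = M * (p + q) + N%:Z * k, z 0 1 = M * p, z 0 2 = M * q &
      z 0 4 = N%:Z * t - z 0 3].
Proof.
have NM := half_double_int.
split.
  case/mem_g0_span=> u [v []]; rewrite !mxE -(natr_Zp u) -(natr_Zp v).
  move: (u : nat) (v : nat) => {u v} u v z0 z1 z2 z4.
  have [k1 z1E] : exists k, z 0 1 = (N %/ 2)%:Z * u%:Z + N%:Z * k.
    by apply: intr_Zp_eq; rewrite z1 rmorphM.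
  have [k2 z2E] : exists k, z 0 2 = (N %/ 2)%:Z * v%:Z + N%:Z * k.
    by apply: intr_Zp_eq; rewrite z2 rmorphM.
  have [k0 z0E] : exists k, z 0 0 = (N %/ 2)%:Z * (u%:Z + v%:Z) + N%:Z * k.
    by apply: intr_Zp_eq; rewrite z0 rmorphM rmorphD.
  have [k4 z4E] : exists k, z 0 4 = - z 0 3 + N%:Z * k.
    by apply: intr_Zp_eq; rewrite z4 rmorphN.
  exists (u%:Z + 2 * k1), (v%:Z + 2 * k2), (k0 - k1 - k2), k4.
  by rewrite z0E z1E z2E z4E NM; split; ring.
move=> [p [q [k [t [z0 z1 z2 z4]]]]]; apply/mem_g0_span.
have N0 : N%:~R = 0 :> 'Z_N by exact: pchar_Zp.
exists p%:~R, q%:~R; rewrite !mxE z0 z1 z2 z4.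
split; rewrite ?rmorphB ?rmorphD !rmorphM ?rmorphD /=; ring: N0.
Qed.

Lemma join_map_lattice :
  [set x *m join_map | x in code_lattice R (code_span (g0_mx N))] =
  int_lattice R 4.
Proof.
have NM : N%:R = 2 * (N %/ 2)%:R :> R by rewrite {1}(half_double N) // natrM mulrC.
have M0 : (N %/ 2)%:R != 0 :> R.
  by move: N_neq0; rewrite NM mulf_eq0 negb_or => /andP[].
rewrite eqEsubset; split=> [_ [_ [_ [z /g0_preimageP zP <-]] <-] | _ [y _ <-]].
  have [p [q [k [t [z0 z1 z2 z4]]]]] := zP.
  exists (\row_(j < 4) [:: p; q; z 0 3; t]`_j) => //.
  have [y0 y1 y2 y3] := join_mapE (map_mx intr z).
  apply/rowP; apply: forall_ord4; rewrite ?y0 ?y1 ?y2 ?y3 !mxE /= ?z1 ?z2 ?z4 //.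
  - by rewrite rmorphM /= NM; field.
  - by rewrite rmorphM /= NM; field.
  - by rewrite rmorphB rmorphM /=; field.
set x := map_mx _ y; exists (join_inv x); last exact: join_invK.
split.
  rewrite (aff_hull_vertices N 5); [exact: join_inv_sum | exact: ltnW | by [] |].
  by move=> v /= /(vertex_sum N 5).
pose M := (N %/ 2)%:Z; pose z : 'rV[int]_5 := \row_(i < 5)
  [:: N%:Z - M * y 0 0 - M * y 0 1 - N%:Z * y 0 3; M * y 0 0; M * y 0 1;
      y 0 2; N%:Z * y 0 3 - y 0 2]`_i.
exists z.
  apply/g0_preimageP; exists (y 0 0), (y 0 1), (1 - y 0 3 - y 0 0 - y 0 1), (y 0 3).
  rewrite !mxE /= /M half_double_int; split; ring.
apply/rowP; apply: forall_ord5; rewrite !mxE /= ?rmorphB ?rmorphM /= /M;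
  by rewrite -?pmulrn ?NM; field.
Qed.

Lemma g0_unimodular_iso :
  unimodular_iso (code_lattice R (code_span (g0_mx N))) (code_simplex R N 5)
    (int_lattice R (2 + 1 + 1)) (free_join (two_Delta2 R) (interval_of_length R N)).
Proof.
exists join_map, 0 => f.
have -> : f = mulmx^~ join_map by apply/funext => x; rewrite /f addr0.
split; [exact: join_map_bij join_map_simplex | exact: join_map_lattice |].
exact: join_map_simplex.
Qed.

End JoinMap.

Theorem lemma3p10 (R : realType) (N : nat) (a : int)
    (N_ge2 : (2 <= N)%N) (N_even : ~~ odd N) (a_odd : ~~ (2 %| a)%Z) :
  let C := code_span (g_mx N a) in
  let C0 := code_span (g0_mx N) in
  [/\ code_iso C C0,
      @direct_sum 2 N N 3 2 (code_span h1_mx) (code_span (h2_mx N)) C0,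
      zero_sum_code C /\ zero_sum_code C0,
      unimodular_iso (code_lattice R C) (code_simplex R N 5)
        (int_lattice R (2 + 1 + 1))
        (free_join (two_Delta2 R) (interval_of_length R N))
    & unimodular_iso (code_lattice R C0) (code_simplex R N 5)
        (int_lattice R (2 + 1 + 1))
        (free_join (two_Delta2 R) (interval_of_length R N))].
Proof.
move=> C C0; have CC0 : C = C0 by exact: g_span_eq.
rewrite CC0; split.
- exists 1%g; rewrite eqEsubset; split=> [_ [c Cc <-] | c Cc].
    by rewrite col_perm1.
  by exists c; rewrite ?col_perm1.
- exact: g0_direct_sum.
- by split; apply: g0_span_zero_sum.
- exact: g0_unimodular_iso.
- exact: g0_unimodular_iso.
Qed.
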